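(* For every integer $n\ge 0$, $$T_{n+2}=\sum_{k=0}^{n}N_kT_{n-k}+N_n,$$ where $T_j$ are the tribonacci numbers and $N_j$ is Narayana's cows sequence.
   Context: Tribonacci numbers: $T_0=T_1=0$, $T_2=1$, $T_n=T_{n-1}+T_{n-2}+T_{n-3}$ for $n\ge3$. Narayana's cows sequence: $N_0=N_1=N_2=1$, $N_n=N_{n-1}+N_{n-3}$ for $n\ge 3$. *)

(* Defs.v *)
From mathcomp Require Import all_boot.

Set Implicit Arguments.
Unset Strict Implicit.
Unset Printing Implicit Defensive.

Fixpoint tribonacci (n : nat) : nat :=
  match n with
  | 0 => 0
  | 1 => 0
  | 2 => 1
  | ((k.+1 as k1).+1 as k2).+1 => tribonacci k2 + tribonacci k1 + tribonacci k
  end.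

(* N_0 = N_1 = N_2 = 1 (some references shift the index) *)
Fixpoint narayana (n : nat) : nat :=
  match n with
  | 0 => 1
  | 1 => 1
  | 2 => 1
  | ((k.+1).+1 as k2).+1 => narayana k2 + narayana k
  end.

(* Main.v *)
(** The convolution S_n = \sum_(k <= n) N_k T_(n-k) inherits from the recurrence
    of N the relation S_(n+3) = S_(n+2) + S_n + T_(n+3). The sequence
    T_(n+2) - N_n satisfies the same relation, so the two agree by induction. *)
Require Import Defs.
From mathcomp Require Import all_boot.
From mathcomp Require Import zify.

Lemma tribonacciSSS (n : nat) :
  tribonacci n.+3 = tribonacci n.+2 + tribonacci n.+1 + tribonacci n.
Proof. by []. Qed.

Lemma narayanaSSS (n : nat) : narayana n.+3 = narayana n.+2 + narayana n.
Proof. by []. Qed.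

(** The recurrence splits only the terms with index at least 3. Since N_0 = N_1 = N_2 = 1, the
    boundary terms in [f n.+2] and [f n.+1] cancel, leaving [f n.+3]. *)
Lemma narayana_convolutionSSS (f : nat -> nat) (n : nat) :
  \sum_(0 <= k < n.+4) narayana k * f (n.+3 - k) =
    \sum_(0 <= k < n.+3) narayana k * f (n.+2 - k) +
    \sum_(0 <= k < n.+1) narayana k * f (n - k) + f n.+3.
Proof.
do 3 rewrite [in LHS]big_nat_recl //.
(* Peeling one term fewer here aligns all remaining sums on k < n+1. *)
do 2 rewrite [in X in _ = X + _ + _]big_nat_recl //.
under eq_bigr => k _ do rewrite narayanaSSS !subSS mulnDl.
rewrite big_split /= !subSS !subn0 !mul1n.
under [in RHS]eq_bigr => k _ do rewrite !subSS.
lia.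
Qed.

Theorem theorem16 (n : nat) :
  tribonacci n.+2 =
    \sum_(0 <= k < n.+1) narayana k * tribonacci (n - k) + narayana n.
Proof.
(* Unlocking lets the sums for n = 0, 1, 2 compute. *)
elim/ltn_ind: n => -[|[|[|n]]] IH; try by rewrite unlock.
(* In the goal at [n.+3], [tribonacci n.+3] appears on both sides and cancels, so only these two
   instances enter. *)
have IH0 := IH n; have IH2 := IH n.+2.
rewrite narayana_convolutionSSS narayanaSSS tribonacciSSS.
rewrite IH2 // [tribonacci n.+2]IH0 //; lia.
Qed.
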